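(* If the symbol error rate $P_e(\gamma)$ is a convex function of the SNR $\gamma$ in the non-fading AWGN channel (for example, for any constellation of dimension 1 or 2 with maximum-likelihood detection), then fading never reduces the symbol error rate compared to the non-fading channel at the same average SNR: for any distribution of the random SNR $\gamma$, $$\overline{P_e(\gamma)}\ge P_e(\overline{\gamma}),$$ where the overline denotes mean value.
   Context: Symbol error rate: a constellation is a set of $M\ge2$ distinct points $\mathbf{s}_1,\dots,\mathbf{s}_M\in\mathbb{R}^n$ ($n$ is its dimension), normalized by $\frac1M\sum_i|\mathbf{s}_i|^2=1$, with prior probabilities $\Pr[\mathbf{s}=\mathbf{s}_i]$ summing to 1. With decision regions $\Omega_i=\{\mathbf{x}\in\mathbb{R}^n:\ (\mathbf{s}_j-\mathbf{s}_i)^T\mathbf{x}\le\frac12|\mathbf{s}_j-\mathbf{s}_i|^2\ \forall j\ne i\}$ of the maximum-likelihood (minimum distance) detector, $P_{ei}(\gamma)=1-\int_{\Omega_i}\left(\frac{\gamma}{2\pi}\right)^{n/2}e^{-\gamma|\mathbf{x}|^2/2}\,d\mathbf{x}$ for SNR $\gamma>0$, and $P_e=\sum_iP_{ei}\Pr[\mathbf{s}=\mathbf{s}_i]$, with $P_e(0)$ the limit as $\gamma\to0^+$. In a frequency-flat slow-fading channel the SNR $\gamma$ is a nonnegative random variable with finite mean $\overline\gamma$, and the average symbol error rate is $\overline{P_e(\gamma)}=\mathbb{E}[P_e(\gamma)]$. *)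

(* Defs.v *)
From HB Require Import structures.
From mathcomp Require Import all_boot all_order all_algebra.
From mathcomp Require Import all_classical all_reals all_analysis.

Set Implicit Arguments.
Unset Strict Implicit.
Unset Printing Implicit Defensive.

Import Order.TTheory GRing.Theory Num.Theory.
Import numFieldNormedType.Exports.

Local Open Scope classical_set_scope.
Local Open Scope ring_scope.

(* R^n with the product of the Borel sigma-algebras. *)
Notation Rn R n := (n.-tuple (measurableTypeR R)).

Section lebesgue_measure_Rn.
Context {R : realType}.

Definition cons_Rn n (p : measurableTypeR R * Rn R n) : Rn R n.+1 :=
  [tuple of p.1 :: p.2].

Lemma measurable_cons_Rn n : measurable_fun [set: _] (@cons_Rn n).
Proof.
exact: (measurable_cons (f := fst) (g := snd) measurable_fst measurable_snd).
Qed.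

Section step.
Context n (mu : {sigma_finite_measure set (Rn R n) -> \bar R}).

Definition lebesgue_step : set (Rn R n.+1) -> \bar R :=
  pushforward (@lebesgue_measure R \x mu)%E (@cons_Rn n).

Let preimage_cons_measurable (A : set (Rn R n.+1)) :
  measurable A -> measurable (@cons_Rn n @^-1` A).
Proof.
by move=> mA; rewrite -[X in measurable X]setTI; exact: measurable_cons_Rn.
Qed.

Let lebesgue_step0 : lebesgue_step set0 = 0%E.
Proof. by rewrite /lebesgue_step /pushforward preimage_set0 measure0. Qed.

Let lebesgue_step_ge0 A : (0 <= lebesgue_step A)%E.
Proof. by rewrite /lebesgue_step /pushforward measure_ge0. Qed.

Let lebesgue_step_sigma_additive : semi_sigma_additive lebesgue_step.
Proof.
move=> F mF tF mUF; rewrite /lebesgue_step /pushforward preimage_bigcup.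
apply: measure_semi_sigma_additive.
- by move=> k; exact: preimage_cons_measurable.
- apply/trivIsetP => /= i j _ _ ij; rewrite -preimage_setI.
  by move/trivIsetP : tF => /(_ _ _ _ _ ij) ->//; rewrite preimage_set0.
- by rewrite -preimage_bigcup; exact: preimage_cons_measurable.
Qed.

HB.instance Definition _ := isMeasure.Build _ _ _
  lebesgue_step lebesgue_step0 lebesgue_step_ge0 lebesgue_step_sigma_additive.

Let lebesgue_step_sigma_finite : sigma_finite setT lebesgue_step.
Proof.
have /sigma_finiteP[F [TF ndF Foo]] := sigma_finiteT (@lebesgue_measure R).
have /sigma_finiteP[G [TG ndG Goo]] := sigma_finiteT mu.
pose uncons (x : Rn R n.+1) : measurableTypeR R * Rn R n :=
  (tnth x ord0, [tuple of behead x]).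
have munc : measurable_fun setT uncons.
  apply/measurable_fun_pairP; split; first exact: measurable_tnth.
  exact: measurable_behead.
have consK : cancel (@cons_Rn n) uncons.
  by move=> [a t]; congr (_, _); exact: val_inj.
exists (fun k => uncons @^-1` (F k `*` G k)).
  rewrite predeqE => x; split => // _.
  have [k _ Fk] : (\bigcup_k F k) (uncons x).1 by rewrite -TF.
  have [l _ Gl] : (\bigcup_k G k) (uncons x).2 by rewrite -TG.
  exists (maxn k l) => //; split.
  - by move: Fk; exact/subsetPset/ndF/leq_maxl.
  - by move: Gl; exact/subsetPset/ndG/leq_maxr.
move=> k; have [mF Fk] := Foo k; have [mG Gk] := Goo k; split.
  by rewrite -[X in measurable X]setTI; apply: munc => //; exact: measurableX.
rewrite /lebesgue_step /pushforward -comp_preimage.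
rewrite (_ : uncons \o _ = id); last by apply/funext => x; exact: consK.
by rewrite preimage_id product_measure1E// lte_mul_pinfty// ge0_fin_numE.
Qed.

HB.instance Definition _ := Measure_isSigmaFinite.Build _ _ _
  lebesgue_step lebesgue_step_sigma_finite.

End step.

(* n-dimensional Lebesgue measure, as the n-fold product of the Lebesgue
   measure on R (characterized on boxes by lebesgue_Rn_box). *)
Fixpoint lebesgue_Rn n : {sigma_finite_measure set (Rn R n) -> \bar R} :=
  match n return {sigma_finite_measure set (Rn R n) -> \bar R} with
  | 0%N => \d_([tuple] : Rn R 0)
  | m.+1 => lebesgue_step (lebesgue_Rn m)
  end.

Lemma lebesgue_Rn_box n (A : 'I_n -> set (measurableTypeR R)) :
  (forall k, measurable (A k)) ->
  lebesgue_Rn n [set x | forall k, A k (tnth x k)] =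
  (\prod_(k < n) lebesgue_measure (A k))%E.
Proof.
elim: n A => [|n IHn] A mA.
  rewrite big_ord0 /= diracE mem_set//.
  by case.
rewrite big_ord_recl -IHn; last by move=> k; exact: mA.
rewrite -product_measure1E//=.
  rewrite /lebesgue_step /pushforward; congr (_ _).
  apply/seteqP; split => -[a t] /=.
    move=> h; split; first exact: (h ord0).
    by move=> k; have := h (lift ord0 k); rewrite tnthS.
  move=> [Aa At] k; have [->//|/eqP/eqP k0] := eqVneq k ord0.
  by have [j ->|] := unliftP ord0 k; [rewrite tnthS; exact: At | move/eqP: k0].
rewrite (_ : [set x | _] = \bigcap_k
  [set x : Rn R n | A (lift ord0 k) (tnth x k)]); last first.
  by apply/seteqP; split => x /= h k; [move=> _|]; exact: h.
apply: fin_bigcap_measurable => // k _.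
rewrite -[X in measurable X]setTI.
exact: (measurable_tnth k).
Qed.

End lebesgue_measure_Rn.

Section symbol_error_rate.
Context {R : realType}.
Variables (n M : nat) (s : 'I_M -> Rn R n) (p : 'I_M -> R).

Definition dotRn (x y : Rn R n) : R := \sum_(k < n) tnth x k * tnth y k.

Definition subRn (x y : Rn R n) : Rn R n :=
  [tuple tnth x k - tnth y k | k < n].

Definition sqnormRn (x : Rn R n) : R := dotRn x x.

(* Decision regions of the minimum-distance detector, centered at the
   transmitted point: x is the noise vector. *)
Definition decision_region (i : 'I_M) : set (Rn R n) :=
  [set x | forall j, j != i ->
    dotRn (subRn (s j) (s i)) x <= 2^-1 * sqnormRn (subRn (s j) (s i))].

Definition gaussian_density (g : R) (x : Rn R n) : R :=
  (g / (2 * pi)) `^ (n%:R / 2) * expR (- (g * sqnormRn x / 2)).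

Definition cond_error_rate (i : 'I_M) (g : R) : R :=
  1 - \int[lebesgue_Rn n]_(x in decision_region i) gaussian_density g x.

Definition error_rate_pos (g : R) : R := \sum_(i < M) cond_error_rate i g * p i.

(* The integral formula only makes sense for g > 0; the value at 0 is the
   limit at 0^+ (negative arguments are irrelevant). *)
Definition error_rate (g : R) : R :=
  if 0 < g then error_rate_pos g else lim (error_rate_pos x @[x --> 0^'+]).

(* M >= 2 distinct points with unit average energy. *)
Definition constellation : Prop :=
  [/\ (2 <= M)%N, injective s & M%:R^-1 * (\sum_(i < M) sqnormRn (s i)) = 1].

Definition prior : Prop := (forall i, 0 <= p i) /\ \sum_(i < M) p i = 1.

End symbol_error_rate.

(* Main.v *)
(* The probability of correct detection is the Gaussian measure of the decision
   region Omega, which is star-shaped about 0. In the plane, slice Omega by the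
   lines y = x t, so that dx dy = |x| dx dt: on each half-line Omega is an
   interval from 0 to some b in [0, +oo], and
     int_0^b x g exp (- g c x^2) dx = (1 - exp (- g c b^2)) / (2 c)
   is concave in g; integrating over t shows that the error rate is convex on
   ]0, +oo[. A region of dimension 1 is reduced to the plane by adjoining an
   independent Gaussian coordinate. Being convex and at most 1 on ]0, +oo[, the
   error rate is nonincreasing, so it has a limit at 0^+ and convexity extends
   to [0, +oo[. The averaging inequality is Jensen's, proved with a supporting
   line at the mean; that line may fail to exist at mean 0, where the SNR
   vanishes almost surely. *)
Require Import Defs.
From HB Require Import structures.
From mathcomp Require Import all_boot all_order all_algebra.
From mathcomp Require Import all_classical all_reals all_analysis.
From mathcomp Require Import measurable_realfun ring lra.

Import Order.TTheory GRing.Theory Num.Theory.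
Import numFieldNormedType.Exports.

Local Open Scope classical_set_scope.
Local Open Scope ring_scope.

(** * Scaling on the line and slicing of the right half-plane by slopes *)

Lemma ge0_integral_scale {R : realType} (k : R) (f : R -> \bar R) :
  0 < k -> measurable_fun [set: R] f -> (forall x, 0 <= f x)%E ->
  (\int[lebesgue_measure]_x f x =
   k%:E * \int[lebesgue_measure]_x f (k * x)%R)%E.
Proof.
move=> k0 mf f0.
pose phi : measurableTypeR R -> measurableTypeR R := fun x => k * x.
have mphi : measurable_fun setT phi by exact: measurable_funM.
transitivity (k%:E * \int[pushforward lebesgue_measure phi]_x f x)%E; last first.
  by rewrite ge0_integral_pushforward.
pose nu : {measure set (measurableTypeR R) -> \bar R} :=
  measure_function_pushforward__canonical__measure_function_Measure lebesgue_measure mphi.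
transitivity (\int[mscale (NngNum (ltW k0)) nu]_x f x)%E; last first.
  by rewrite ge0_integral_mscale.
apply: eq_measure_integral => //= A mA AS.
(* The rescaled pushforward gives []a, b]] the value [k * (b / k - a / k) = b - a], and a measure
   with these values on intervals is the Lebesgue measure. *)
apply: (lebesgue_measure_unique (mu := mscale (NngNum (ltW k0)) nu)) => //= _ [[a b]] _ <-.
rewrite /= /mscale/= /pushforward.
rewrite (_ : phi @^-1` _ = `]a / k, b / k]%classic); last first.
  apply/seteqP; split => x; rewrite /phi/= !in_itv/= ltr_pdivrMr// ler_pdivlMr//;
    by rewrite mulrC.
rewrite !lebesgue_measure_itv/= !lte_fin ltr_pM2r ?invr_gt0//.
case: ifPn => ab; last by rewrite mule0.
by rewrite -!EFinB -mulrBl -EFinM mulrC divfK// gt_eqF.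
Qed.

Lemma integral_mkcond_indic d (T : measurableType d) (R : realType)
    (mu : {measure set T -> \bar R}) (D : set T) (f : T -> \bar R) :
  (\int[mu]_(x in D) f x = \int[mu]_x ((\1_D x)%:E * f x))%E.
Proof.
rewrite integral_mkcond epatch_indic.
by apply: eq_integral => x _; rewrite /= muleC.
Qed.

Section right_half_plane.
Context {R : realType} (h : measurableTypeR R * measurableTypeR R -> \bar R).
Hypothesis mh : measurable_fun setT h.
Hypothesis h0 : forall z, (0 <= h z)%E.

Let D : set (measurableTypeR R) := `]0%R, +oo[%classic.

Let mD : measurable D. Proof. exact: measurable_itv. Qed.

(** The integrand after the substitution y = x t, extended by zero to the whole plane so that
    Tonelli's theorem applies to the full product. *)
Let k (z : measurableTypeR R * measurableTypeR R) : \bar R :=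
  ((\1_D z.1)%:E * (z.1%:E * h (z.1, z.1 * z.2)%R))%E.

Let k0 z : (0 <= k z)%E.
Proof.
rewrite /k indicE; have [zD|] := boolP (z.1 \in D); last by rewrite mul0e.
rewrite mul1e mule_ge0// lee_fin.
by move: zD; rewrite inE /D/= in_itv/= andbT => /ltW.
Qed.

Let mk : measurable_fun setT k.
Proof.
apply: emeasurable_funM.
  apply/measurable_EFinP; apply: measurableT_comp => //.
apply: emeasurable_funM; first exact/measurable_EFinP.
apply: measurableT_comp => //.
apply/measurable_fun_pairP; split; first exact: measurable_fst.
exact: (measurable_funM (measurable_fst : measurable_fun setT (fst : _ -> R))
  (measurable_snd : measurable_fun setT (snd : _ -> R))).
Qed.

Lemma measurable_integral_slope : measurable_fun setT
  (fun t : measurableTypeR R =>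
    \int[lebesgue_measure]_(x in `]0%R, +oo[) (x%:E * h (x, x * t)%R))%E.
Proof.
rewrite (_ : (fun _ => _) = fubini_G lebesgue_measure k).
  exact: measurable_fun_fubini_tonelli_G.
by apply/funext => t; rewrite integral_mkcond_indic.
Qed.

(* Substitution y = x t in the inner integral, then Tonelli. *)
Lemma integral_right_half_plane :
  (\int[lebesgue_measure]_(x in `]0%R, +oo[) \int[lebesgue_measure]_y h (x, y) =
   \int[lebesgue_measure]_t \int[lebesgue_measure]_(x in `]0%R, +oo[)
     (x%:E * h (x, x * t)%R))%E.
Proof.
transitivity (\int[lebesgue_measure]_x \int[lebesgue_measure]_y k (x, y))%E.
  rewrite integral_mkcond_indic; apply: eq_integral => x _.
  rewrite /k/= -/D indicE; have [xD|] := boolP (x \in D); last first.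
    by rewrite mul0e; under eq_integral do rewrite mul0e; rewrite integral0.
  under [RHS]eq_integral do rewrite mul1e.
  have x0 : 0 < x by move: xD; rewrite inE /D/= in_itv/= andbT.
  have mhx : measurable_fun [set: R] (fun y : R => h (x, y)).
    exact: measurableT_comp.
  rewrite mul1e (ge0_integral_scale _ _ x0)// ge0_integralZl//.
  - by apply: (measurableT_comp mhx); exact: measurable_funM.
  - by rewrite lee_fin ltW.
transitivity (\int[lebesgue_measure]_t \int[lebesgue_measure]_x k (x, t))%E.
  exact: (fubini_tonelli k).
by apply: eq_integral => t _; rewrite [RHS]integral_mkcond_indic.
Qed.

End right_half_plane.

(** * Integrals of x exp (- k x^2) over subsets of ]0, +oo[ *)

Lemma is_derive_expRNsqr {R : realType} (k x : R) :
  is_derive x 1 (fun x : R => - (2 * k)^-1 * expR (- (k * x ^+ 2)))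
    ((2 * k)^-1 * (2 * k) * (x * expR (- (k * x ^+ 2)))).
Proof.
have h : is_derive x 1 (fun x : R => expR (- (k * x ^+ 2)))
    (expR (- (k * x ^+ 2)) * (- (k * (2 * x)))).
  have : is_derive x 1 (fun x : R => - (k * x ^+ 2)) (- (k * (2 * x))).
    apply: is_derive_eq; rewrite /GRing.scale/=; ring.
  move=> ?; apply: is_derive1_comp.
apply: is_derive_eq; rewrite /GRing.scale/=; ring.
Qed.

Lemma continuous_xexpRNsqr {R : realType} (k : R) :
  continuous (fun x : R => x * expR (- (k * x ^+ 2))).
Proof.
move=> x; apply: cvgM; first exact: cvg_id.
apply: (cvg_comp _ expR); last exact: continuous_expR.
apply: cvgN; apply: cvgM; first exact: cvg_cst.
exact: sqr_continuous.
Qed.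

Lemma integral_xexpRNsqr_itv {R : realType} (k b : R) : 0 < k -> 0 < b ->
  (\int[lebesgue_measure]_(x in `]0%R, b]) (x * expR (- (k * x ^+ 2)))%:E =
   ((2 * k)^-1 * (1 - expR (- (k * b ^+ 2))))%:E)%E.
Proof.
move=> k0 b0; have cf := continuous_xexpRNsqr k.
have dF (x : R) := is_derive_expRNsqr k x.
(* [is_derive_expRNsqr] keeps this factor uncancelled so as to hold for every [k]; it cancels here
   because [0 < k]. *)
have kk : (2 * k)^-1 * (2 * k) = 1 by rewrite mulVf// gt_eqF// mulr_gt0.
have cF : continuous (fun x : R => - (2 * k)^-1 * expR (- (k * x ^+ 2))).
  by move=> x; apply: differentiable_continuous; apply/derivable1_diffP; case: (dF x).
rewrite integral_itv_obnd_cbnd; last first.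
  apply/measurable_EFinP; apply: measurable_funTS.
  exact: continuous_measurable_fun.
rewrite (@continuous_FTC2 _ _ (fun x : R => - (2 * k)^-1 * expR (- (k * x ^+ 2))))//.
- by rewrite -EFinB expr0n/= mulr0 oppr0 expR0; congr EFin; ring.
- exact: continuous_subspaceT.
- split.
  + by move=> x _; case: (dF x).
  + exact/cvg_at_right_filter/cF.
  + exact/cvg_at_left_filter/cF.
- by move=> x _; rewrite derive1E; case: (dF x) => _ ->; rewrite kk mul1r.
Qed.

Lemma integral_xexpRNsqry {R : realType} (k : R) : 0 < k ->
  (\int[lebesgue_measure]_(x in `]0%R, +oo[) (x * expR (- (k * x ^+ 2)))%:E =
   ((2 * k)^-1)%:E)%E.
Proof.
move=> k0; have cf := continuous_xexpRNsqr k.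
have dF (x : R) := is_derive_expRNsqr k x.
have kk : (2 * k)^-1 * (2 * k) = 1 by rewrite mulVf// gt_eqF// mulr_gt0.
have cF : continuous (fun x : R => - (2 * k)^-1 * expR (- (k * x ^+ 2))).
  by move=> x; apply: differentiable_continuous; apply/derivable1_diffP; case: (dF x).
rewrite integral_itv_obnd_cbnd; last first.
  apply/measurable_EFinP; apply: measurable_funTS.
  exact: continuous_measurable_fun.
rewrite (@ge0_continuous_FTC2y _ _
  (fun x : R => - (2 * k)^-1 * expR (- (k * x ^+ 2))) _ 0)//.
- by rewrite -EFinB expr0n/= mulr0 oppr0 expR0; congr EFin; ring.
- by move=> x x0; rewrite mulr_ge0// expR_ge0.
- exact: continuous_subspaceT.
- rewrite -[X in _ --> X](mulr0 (- (2 * k)^-1)).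
  apply: cvgM; first exact: cvg_cst.
  apply: (cvg_comp (fun x : R => k * x ^+ 2) (fun x : R => expR (- x))); last exact: cvgr_expR.
  exact/gt0_cvgMry/cvgr_expr2.
- exact/cvg_at_right_filter/cF.
- by move=> x _; rewrite derive1E; case: (dF x) => _ ->; rewrite kk mul1r.
Qed.

(* J meets ]0, +oo[ in an interval with left end 0 and right end b: v = 0 covers
   b = 0 (u = 0) and b = +oo (u = 1), otherwise u = v = 1 and w = b^2. *)
Lemma integral_xexpRNsqr_star {R : realType} (J : set (measurableTypeR R)) :
  measurable J -> (forall x l : R, J x -> 0 <= l <= 1 -> J (l * x)) ->
  exists u v w : R, 0 <= v /\ forall k : R, 0 < k ->
    (\int[lebesgue_measure]_(x in J `&` `]0%R, +oo[)
       (x * expR (- (k * x ^+ 2)))%:E =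
     ((2 * k)^-1 * (u - v * expR (- (k * w))))%:E)%E.
Proof.
move=> mJ starJ; set K := J `&` _.
(* Since x = (x / y) y with a ratio in [0, 1], star-shapedness makes [K] downward closed in ]0,
   +oo[. *)
have Kdown (x y : R) : K y -> 0 < x -> x <= y -> K x.
  rewrite /K/= !in_itv/= !andbT => -[Jy y0] x0 xy; split => //.
  have -> : x = x / y * y by rewrite divfK// gt_eqF.
  apply: starJ => //.
  by rewrite ltW ?divr_gt0//= ler_pdivrMr// mul1r.
have [K0|/set0P[x0 Kx0]] := eqVneq K set0.
  exists 0, 0, 0; split => // k k0.
  by rewrite K0 integral_set0 mul0r subrr mulr0.
have [ubK|nubK] := pselect (has_ubound K); last first.
  exists 1, 0, 0; split => // k k0.
  rewrite mul0r subr0 mulr1 -integral_xexpRNsqry//; congr integral.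
  apply/seteqP; split => x; first by case.
  rewrite /= in_itv/= andbT => x1; apply: contrapT => nKx; apply: nubK.
  exists x => y Ky; rewrite leNgt; apply/negP => /ltW xy.
  exact/nKx/(Kdown x y).
have supK x : K x -> x <= sup K.
  by move=> Kx; apply: ub_le_sup.
have K0y x : K x -> 0 < x by case; rewrite /= in_itv/= andbT.
have b0 : 0 < sup K by exact: lt_le_trans (K0y _ Kx0) (supK _ Kx0).
exists 1, 1, (sup K ^+ 2); split => // k k0.
have lt_supK x : 0 < x -> x < sup K -> K x.
  move=> x1 /sup_gt[|y Ky /ltW xy]; first by exists x0.
  exact: Kdown Ky x1 xy.
rewrite mul1r -integral_xexpRNsqr_itv//.
(* [K] is the interval from 0 to its supremum, closed or open there; the endpoint has measure
   zero. *)
have [Kb|nKb] := pselect (K (sup K)).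
  congr integral; apply/seteqP; split => x; rewrite /= in_itv/=.
    by move=> Kx; rewrite K0y// supK.
  by move=> /andP[x1]; rewrite le_eqVlt => /predU1P[->//|]; exact: lt_supK.
rewrite -integral_itv_bndo_bndc; last first.
  apply/measurable_EFinP; apply: measurable_funTS.
  exact: (continuous_measurable_fun (@continuous_xexpRNsqr R k)).
congr integral; apply/seteqP; split => x; rewrite /= in_itv/=.
  move=> Kx; rewrite K0y//= lt_neqAle supK// andbT.
  by apply/eqP => xb; apply: nKb; rewrite -xb.
by move=> /andP[]; exact: lt_supK.
Qed.

(** * Concavity on ]0, +oo[ with extended real values *)

Definition econcave_gt0 {R : realType} (F : R -> \bar R) :=
  forall a b l : R, 0 < a -> 0 < b -> 0 <= l <= 1 ->
    (l%:E * F a + (1 - l)%:E * F b <= F (l * a + (1 - l) * b)%R)%E.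

Lemma conv_gt0 {R : realType} (a b l : R) :
  0 < a -> 0 < b -> 0 <= l <= 1 -> 0 < l * a + (1 - l) * b.
Proof. by move=> a0 b0 /andP[l0 l1]; nra. Qed.

Lemma eq_econcave_gt0 {R : realType} (F G : R -> \bar R) :
  (forall g, 0 < g -> F g = G g) -> econcave_gt0 F -> econcave_gt0 G.
Proof.
move=> FG cF a b l a0 b0 l01.
by rewrite -(FG _ a0) -(FG _ b0) -(FG _ (conv_gt0 _ _ _ a0 b0 l01)); exact: cF.
Qed.

(** The pointwise inequality is integrated over the parameter. Nonnegativity alone lets the integral
    distribute over the sum, so finiteness can be settled separately. *)
Lemma econcave_gt0_integral d (T : measurableType d) {R : realType}
    (mu : {measure set T -> \bar R}) (K : T -> R -> \bar R) :
  (forall g, 0 < g -> measurable_fun setT (K ^~ g)) ->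
  (forall t g, (0 < g)%R -> 0 <= K t g)%E ->
  (forall t, econcave_gt0 (K t)) ->
  econcave_gt0 (fun g => \int[mu]_t K t g)%E.
Proof.
move=> mK K0 cK a b l a0 b0 l01; have /andP[l0 l1] := l01.
have c0 := conv_gt0 a b l a0 b0 l01.
have mKa := mK _ a0; have mKb := mK _ b0; have mKc := mK _ c0.
rewrite -!ge0_integralZl//; last 3 first.
- by move=> t _; exact: K0.
- by rewrite lee_fin subr_ge0.
- by move=> t _; exact: K0.
rewrite -ge0_integralD//.
- apply: ge0_le_integral => //.
  + by move=> t _; rewrite adde_ge0// mule_ge0 ?K0// lee_fin// subr_ge0.
  + by apply: emeasurable_funD; apply: measurable_funeM.
  + by move=> t _; exact: cK.
- by move=> t _; rewrite mule_ge0 ?K0.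
- exact: measurable_funeM.
- by move=> t _; rewrite mule_ge0 ?K0// lee_fin subr_ge0.
- exact: measurable_funeM.
Qed.

Lemma econcave_gt0D {R : realType} (F G : R -> \bar R) :
  (forall g, (0 < g)%R -> 0 <= F g)%E -> (forall g, (0 < g)%R -> 0 <= G g)%E ->
  econcave_gt0 F -> econcave_gt0 G ->
  econcave_gt0 (fun g => F g + G g)%E.
Proof.
move=> F0 G0 cF cG a b l a0 b0 l01.
by rewrite !ge0_muleDr ?F0 ?G0// addeACA leeD ?cF ?cG.
Qed.

(** * Mass of planar star-shaped sets under the centred Gaussian of variance 1 / g per coordinate *)

Definition gauss2 {R : realType} (g : R)
    (z : measurableTypeR R * measurableTypeR R) : R :=
  g / (2 * pi) * expR (- (g * (z.1 ^+ 2 + z.2 ^+ 2) / 2)).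

Lemma measurable_gauss2 {R : realType} (g : R) :
  measurable_fun setT (gauss2 g).
Proof.
apply: measurable_funM => //; apply: measurableT_comp => //.
apply: measurableT_comp => //; apply: measurable_funM => //.
apply: measurable_funM => //; apply: measurable_funD; apply: measurable_funX;
  [exact: measurable_fst|exact: measurable_snd].
Qed.

Lemma gauss2_ge0 {R : realType} (g : R) z : 0 < g -> 0 <= gauss2 g z.
Proof.
by move=> g0; rewrite mulr_ge0 ?expR_ge0// divr_ge0 ?ltW// mulr_gt0 ?pi_gt0.
Qed.

Lemma expR_conv {R : realType} (x y l : R) : 0 <= l <= 1 ->
  expR (l * x + (1 - l) * y) <= l * expR x + (1 - l) * expR y.
Proof.
by move=> /andP[l0 l1]; exact: (convex_expR (Itv01 l0 l1) x y).
Qed.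

Section star_shaped.
Context {R : realType} (A : set (measurableTypeR R * measurableTypeR R)).
Hypothesis mA : measurable A.
Hypothesis starA : forall (z : R * R) (l : R),
  A z -> 0 <= l <= 1 -> A (l * z.1, l * z.2).

Let h g z := (\1_A z * gauss2 g z)%:E.

Let mh g : measurable_fun setT (h g).
Proof.
by apply/measurable_EFinP/measurable_funM => //; exact: measurable_gauss2.
Qed.

Let h0 g z : 0 < g -> (0 <= h g z)%E.
Proof. by move=> g0; rewrite lee_fin mulr_ge0 ?gauss2_ge0. Qed.

Lemma econcave_gt0_half_plane : econcave_gt0 (fun g =>
  \int[lebesgue_measure]_(x in `]0%R, +oo[)
    \int[lebesgue_measure]_y (\1_A (x, y) * gauss2 g (x, y))%:E)%E.
Proof.
pose D : set (measurableTypeR R) := `]0%R, +oo[%classic.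
have mD : measurable D by exact: measurable_itv.
pose K (t : measurableTypeR R) (g : R) : \bar R :=
  (\int[lebesgue_measure]_(x in D) (x%:E * h g (x, x * t)%R))%E.
have DP x : D x -> 0 <= x by rewrite /D/= in_itv/= andbT => /ltW.
have KE g : 0 < g -> (\int[lebesgue_measure]_t K t g =
  \int[lebesgue_measure]_(x in D) \int[lebesgue_measure]_y h g (x, y))%E.
  by move=> g0; rewrite integral_right_half_plane// => z; exact: h0.
apply: (eq_econcave_gt0 _ _ KE).
apply: econcave_gt0_integral.
- by move=> g g0; apply: measurable_integral_slope => // z; exact: h0.
- by move=> t g g0; apply: integral_ge0 => x /DP x0; rewrite mule_ge0// h0.
move=> t.
(* The slice of [A] by the line of slope [t], parametrized by the abscissa, is again star-shaped
   about 0. *)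
pose J : set (measurableTypeR R) := [set x | A (x, x * t)].
have mJ : measurable J.
  have mphi : measurable_fun setT (fun x : measurableTypeR R =>
      (x, x * t) : measurableTypeR R * measurableTypeR R).
    have ms : measurable_fun [set: R] (fun x : R => x * t).
      exact: measurable_funM.
    by apply/measurable_fun_pairP; split; [exact: measurable_id|exact: ms].
  by rewrite -[J]setTI; exact: mphi.
have starJ (x l : R) : J x -> 0 <= l <= 1 -> J (l * x).
  by move=> Jx l01; have := starA _ _ Jx l01; rewrite /J/= mulrA.
have [u [v [w [v0 JE]]]] := integral_xexpRNsqr_star _ mJ starJ.
(* On this line the Gaussian exponent (x^2 + y^2) / 2 equals c x^2. *)
pose c := (1 + t ^+ 2) / 2.
have c0 : 0 < c by rewrite divr_gt0// ltr_pwDl// sqr_ge0.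
have p0 : 0 < 2 * pi :> R by rewrite mulr_gt0// pi_gt0.
(* The factor g of the density cancels the 1 / g produced by the integral, so [g] survives only in
   an exponential with nonpositive coefficient; concavity then follows from convexity of [expR]. *)
have Kt g : 0 < g -> K t g =
    ((2 * pi * (2 * c))^-1 * (u - v * expR (- (g * c * w))))%:E.
  move=> g0; transitivity ((g / (2 * pi))%:E *
      \int[lebesgue_measure]_(x in J `&` D) (x * expR (- (g * c * x ^+ 2)))%:E)%E.
    rewrite -ge0_integralZl//; last 4 first.
    - exact: measurableI.
    - apply/measurable_EFinP; apply: measurable_funTS.
      exact: (continuous_measurable_fun (@continuous_xexpRNsqr R (g * c))).
    - by move=> x [_ /DP x0]; rewrite lee_fin mulr_ge0// expR_ge0.
    - by rewrite lee_fin divr_ge0// ltW.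
    rewrite setIC integral_mkcondr; apply: eq_integral => x _.
    rewrite patchE /h indicE; have -> : ((x, x * t) \in A) = (x \in J) by [].
    case: ifPn => _; last by rewrite mul0r mule0.
    rewrite -!EFinM /gauss2/= mul1r; congr EFin.
    rewrite [LHS]mulrCA; congr (_ * (_ * expR _)).
    by rewrite /c; field.
  rewrite (JE _ (mulr_gt0 g0 c0)).
  rewrite -EFinM; congr EFin.
  move: (2 * pi : R) p0 => q q0; field.
  by rewrite !gt_eqF.
move=> a b l a0 b0 l01; rewrite !Kt ?conv_gt0//.
rewrite -!EFinM -EFinD lee_fin.
rewrite mulrCA [X in _ + X]mulrCA -mulrDr ler_pM2l; last first.
  by rewrite invr_gt0 mulr_gt0// mulr_gt0.
have := expR_conv (- (a * c * w)) (- (b * c * w)) l l01.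
rewrite (_ : _ * - _ + _ = - ((l * a + (1 - l) * b) * c * w)); last by ring.
move=> /(ler_wpM2l v0); lra.
Qed.

End star_shaped.

(** The left half-plane is the mirror image of the right one: the reflected set [B] is still
    star-shaped and the density is even in x, so the integral is a sum of two half-plane
    integrals. *)
Lemma econcave_gt0_plane {R : realType}
    (A : set (measurableTypeR R * measurableTypeR R)) :
  measurable A ->
  (forall (z : R * R) (l : R), A z -> 0 <= l <= 1 -> A (l * z.1, l * z.2)) ->
  econcave_gt0 (fun g => \int[lebesgue_measure]_x
    \int[lebesgue_measure]_y (\1_A (x, y) * gauss2 g (x, y))%:E)%E.
Proof.
move=> mA starA.
pose opp1 (z : measurableTypeR R * measurableTypeR R) :
  measurableTypeR R * measurableTypeR R := (- z.1, z.2).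
have mopp1 : measurable_fun setT opp1.
  apply/measurable_fun_pairP; split; last exact: measurable_snd.
  have mN : measurable_fun [set: R] (-%R : R -> R) by [].
  exact: (measurableT_comp mN measurable_fst).
pose B := opp1 @^-1` A.
have mB : measurable B by rewrite -[B]setTI; exact: mopp1.
have starB (z : R * R) (l : R) : B z -> 0 <= l <= 1 -> B (l * z.1, l * z.2).
  by move=> Bz l01; have := starA _ _ Bz l01; rewrite /B/opp1/= mulrN.
pose F (X : set (measurableTypeR R * measurableTypeR R)) (g : R) :=
  (\int[lebesgue_measure]_(x in `]0%R, +oo[)
     \int[lebesgue_measure]_y (\1_X (x, y) * gauss2 g (x, y))%:E)%E.
have F0 X g : 0 < g -> (0 <= F X g)%E.
  move=> g0; apply: integral_ge0 => x _; apply: integral_ge0 => y _.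
  by rewrite lee_fin mulr_ge0// gauss2_ge0.
suff FE g : 0 < g -> (\int[lebesgue_measure]_x
    \int[lebesgue_measure]_y (\1_A (x, y) * gauss2 g (x, y))%:E)%E =
    (F B g + F A g)%E.
  apply: (eq_econcave_gt0 _ _ (fun g g0 => esym (FE g g0))).
  by apply: econcave_gt0D; [exact: F0|exact: F0|
    exact: econcave_gt0_half_plane|exact: econcave_gt0_half_plane].
move=> g0.
pose f (x : R) : \bar R :=
  (\int[lebesgue_measure]_y (\1_A (x, y) * gauss2 g (x, y))%:E)%E.
have f0 x : (0 <= f x)%E.
  by apply: integral_ge0 => y _; rewrite lee_fin mulr_ge0// gauss2_ge0.
have mf : measurable_fun [set: R] f.
  apply: (measurable_fun_fubini_tonelli_F
    (fun z : measurableTypeR R * measurableTypeR R => (\1_A z * gauss2 g z)%:E)).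
    by apply/measurable_EFinP/measurable_funM => //; exact: measurable_gauss2.
  by move=> z; rewrite lee_fin mulr_ge0// gauss2_ge0.
have mC : measurable (~` (`]-oo, 0%R]%classic : set (measurableTypeR R))).
  by apply: measurableC; exact: measurable_itv.
rewrite -[LHS]/(\int[lebesgue_measure]_x f x)%E.
rewrite -(setUv `]-oo, 0%R]%classic) ge0_integral_setU//=; last 2 first.
- by rewrite setUv.
- exact/disj_setPCl.
rewrite setCitvl; apply: (f_equal2 adde); last by [].
have -> : F B g = (\int[lebesgue_measure]_(x in `]0%R, +oo[) f (- x)%R)%E.
  apply: eq_integral => x _; apply: eq_integral => y _.
  by rewrite /gauss2/= sqrrN.
have mfN : measurable_fun [set: R] (fun x : R => f (- x)).
  exact: measurableT_comp.
(* The half-line is closed at 0 because the change of sign carries it onto []-oo, 0]]. *)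
transitivity (\int[lebesgue_measure]_(x in `[0%R, +oo[) f (- x)%R)%E; last first.
  by apply/esym/integral_itv_obnd_cbnd; exact: measurable_funTS.
rewrite (ge0_integration_by_substitution0 mfN (fun x => f0 (- x))).
by apply: eq_integral => x _; rewrite opprK.
Qed.

(** * Iterated integrals on R^n *)

Lemma ge0_integral_Rn0 {R : realType} (f : Rn R 0 -> \bar R) :
  measurable_fun setT f ->
  (\int[lebesgue_Rn 0]_x f x = f [tuple])%E.
Proof. by move=> mf; rewrite integral_dirac// diracT mul1e. Qed.

(** The measure is by construction the pushforward of a product, so a change of variables followed
    by Tonelli suffices. *)
Lemma ge0_integral_RnS {R : realType} n (f : Rn R n.+1 -> \bar R) :
  measurable_fun setT f -> (forall x, 0 <= f x)%E ->
  (\int[lebesgue_Rn n.+1]_x f x =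
   \int[lebesgue_measure]_a \int[lebesgue_Rn n]_t f (cons_Rn (a, t)))%E.
Proof.
move=> mf f0.
transitivity (\int[(@lebesgue_measure R \x lebesgue_Rn n)%E]_z f (cons_Rn z))%E.
  exact: (ge0_integral_pushforward (@measurable_cons_Rn R n)
    (lebesgue_measure \x lebesgue_Rn n)%E).
apply: (fubini_tonelli1 (fun z => f (cons_Rn z))) => //.
exact: (measurableT_comp mf (@measurable_cons_Rn R n)).
Qed.

(** * Measurability and star-shapedness of the decision regions *)

Section decision_region.
Context {R : realType} (n M : nat) (s : 'I_M -> Rn R n).

Lemma measurable_dotRn (a : Rn R n) : measurable_fun setT (dotRn a).
Proof.
apply: measurable_sum => k; apply: measurable_funM => //.
exact: measurable_tnth.
Qed.

Lemma measurable_sqnormRn : measurable_fun setT (@sqnormRn R n).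
Proof.
apply: measurable_sum => k.
by apply: measurable_funM; exact: measurable_tnth.
Qed.

Lemma sqnormRn_ge0 (x : Rn R n) : 0 <= sqnormRn x.
Proof. by apply: sumr_ge0 => k _; rewrite -expr2 sqr_ge0. Qed.

Lemma measurable_gaussian_density (g : R) :
  measurable_fun setT (@gaussian_density R n g).
Proof.
apply: measurable_funM => //; apply: measurableT_comp => //.
apply: measurableT_comp => //; apply: measurable_funM => //.
by apply: measurable_funM => //; exact: measurable_sqnormRn.
Qed.

Lemma gaussian_density_ge0 (g : R) (x : Rn R n) : 0 <= gaussian_density g x.
Proof. by rewrite mulr_ge0 ?powR_ge0 ?expR_ge0. Qed.

Lemma measurable_decision_region i : measurable (decision_region s i).
Proof.
rewrite (_ : decision_region s i = \bigcap_(j : 'I_M)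
  [set x | j != i -> dotRn (subRn (s j) (s i)) x <=
                     2^-1 * sqnormRn (subRn (s j) (s i))]); last first.
  by apply/seteqP; split => x /= h j; [move=> _|]; exact: h.
apply: fin_bigcap_measurable => // j _.
have [->|ji] := eqVneq j i.
  by rewrite (_ : [set _ | _] = setT)//; apply/seteqP; split.
set a := subRn _ _; set c := _ * _.
rewrite (_ : [set _ | _] = dotRn a @^-1` `]-oo, c]%classic).
  by rewrite -[X in measurable X]setTI; exact: measurable_dotRn.
apply/seteqP; split => x /=; rewrite in_itv/=; first exact.
by move=> + _.
Qed.

(** Each half-space a.x <= c has c >= 0, hence l (a.x) <= l c <= c. The scaled vector [y] is
    described by its coordinates, which suits tuples built with [cons_Rn]. *)
Lemma decision_region_star i (x y : Rn R n) (l : R) : 0 <= l <= 1 ->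
  (forall k, tnth y k = l * tnth x k) ->
  decision_region s i x -> decision_region s i y.
Proof.
move=> /andP[l0 l1] yx + j ji => /(_ j ji).
set a := subRn _ _; set c := _ * _ => xc.
have c0 : 0 <= c by rewrite mulr_ge0 ?invr_ge0 ?sqnormRn_ge0.
have -> : dotRn a y = l * dotRn a x.
  by rewrite /dotRn mulr_sumr; apply: eq_bigr => k _; rewrite yx mulrCA.
by nra.
Qed.

End decision_region.

(** * Gaussian densities and correct detection in dimensions 1 and 2 *)

Definition gauss1 {R : realType} (g x : R) : R :=
  Num.sqrt (g / (2 * pi)) * expR (- (g * x ^+ 2 / 2)).

Lemma gauss1_ge0 {R : realType} (g x : R) : 0 <= gauss1 g x.
Proof. by rewrite mulr_ge0 ?sqrtr_ge0 ?expR_ge0. Qed.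

Lemma measurable_gauss1 {R : realType} (g : R) :
  measurable_fun [set: R] (gauss1 g).
Proof.
apply: measurable_funM => //; apply: measurableT_comp => //.
apply: measurableT_comp => //; apply: measurable_funM => //.
by apply: measurable_funM => //; exact: measurable_funX.
Qed.

(** [gauss1 g] is the normal density of mean 0 and standard deviation [(Num.sqrt g)^-1]. *)
Lemma integral_gauss1 {R : realType} (g : R) : 0 < g ->
  (\int[lebesgue_measure]_x (gauss1 g x)%:E = 1)%E.
Proof.
move=> g0; rewrite -(integral_normal_pdf 0 (Num.sqrt g)^-1).
have sg0 : 0 < Num.sqrt g by rewrite sqrtr_gt0.
have s2 : (Num.sqrt g)^-1 ^+ 2 = g^-1 by rewrite exprVn sqr_sqrtr// ltW.
apply: eq_integral => x _; rewrite normal_pdfE ?invr_eq0 ?gt_eqF//.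
rewrite /gauss1 /normal_peak /normal_fun s2 subr0.
rewrite -sqrtrV ?mulrn_wge0 ?mulr_ge0 ?invr_ge0 ?pi_ge0 ?(ltW g0)//.
congr (Num.sqrt _ * expR _)%:E.
  move: (pi : R) (pi_gt0 R) => p p0; rewrite -mulr_natr; field.
  by rewrite !gt_eqF.
by rewrite -mulr_natr; field; rewrite gt_eqF.
Qed.

Lemma gauss2E {R : realType} (g x y : R) : 0 < g ->
  gauss2 g (x, y) = gauss1 g x * gauss1 g y.
Proof.
move=> g0; rewrite /gauss2 /gauss1/= mulrACA -expr2 sqr_sqrtr; last first.
  by rewrite divr_ge0 ?mulr_ge0 ?pi_ge0// ltW.
by rewrite -expRD; congr (_ * expR _); field.
Qed.

Section dim12.
Context {R : realType} (M : nat).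

Lemma gaussian_density1 (g x : R) : 0 < g ->
  gaussian_density g (cons_Rn (x, [tuple]) : Rn R 1) = gauss1 g x.
Proof.
move=> g0; have p0 : 0 <= g / (2 * pi) by rewrite divr_ge0 ?mulr_ge0 ?pi_ge0// ltW.
rewrite /gaussian_density mul1r powR12_sqrt//; congr (_ * expR (- (g * _ / 2))).
by rewrite /sqnormRn /dotRn big_ord_recl big_ord0 addr0 expr2.
Qed.

Lemma gaussian_density2 (g x y : R) : 0 < g ->
  gaussian_density g (cons_Rn (x, cons_Rn (y, [tuple])) : Rn R 2) =
  gauss2 g (x, y).
Proof.
move=> g0; have p0 : 0 <= g / (2 * pi) by rewrite divr_ge0 ?mulr_ge0 ?pi_ge0// ltW.
rewrite /gaussian_density divff// powRr1//; congr (_ * expR (- (g * _ / 2))).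
by rewrite /sqnormRn /dotRn !big_ord_recl big_ord0 addr0 !expr2.
Qed.

(* The second coordinate of the plane carries an independent Gaussian of mass 1. *)
Lemma correct_prob1 (s : 'I_M -> Rn R 1) i (g : R) : 0 < g ->
  (\int[lebesgue_Rn 1]_(x in decision_region s i) (gaussian_density g x)%:E =
   \int[lebesgue_measure]_x \int[lebesgue_measure]_y
     (\1_[set z : measurableTypeR R * measurableTypeR R |
          decision_region s i (cons_Rn (z.1, [tuple]))] (x, y) *
        gauss2 g (x, y))%:E)%E.
Proof.
move=> g0; rewrite integral_mkcond_indic.
have mf : measurable_fun setT (fun x : Rn R 1 =>
    (\1_(decision_region s i) x)%:E * (gaussian_density g x)%:E)%E.
  apply: emeasurable_funM; apply/measurable_EFinP.
    by apply: measurable_indic; exact: measurable_decision_region.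
  exact: measurable_gaussian_density.
rewrite ge0_integral_RnS//; last first.
  by move=> x; rewrite -EFinM lee_fin mulr_ge0// gaussian_density_ge0.
apply: eq_integral => x _; rewrite ge0_integral_Rn0; last first.
  exact: (measurableT_comp mf (measurableT_comp (@measurable_cons_Rn R 0) (pair1_measurable x))).
rewrite gaussian_density1//.
transitivity (\int[lebesgue_measure]_y
  ((\1_(decision_region s i) (cons_Rn (x, [tuple])) * gauss1 g x)%:E *
   (gauss1 g y)%:E))%E; last first.
  by apply: eq_integral => y _; rewrite gauss2E// -EFinM -mulrA !indicE.
rewrite ge0_integralZl//.
- by rewrite integral_gauss1// mule1 -EFinM.
- by apply/measurable_EFinP; exact: measurable_gauss1.
- by move=> y _; rewrite lee_fin gauss1_ge0.
- by rewrite lee_fin mulr_ge0// gauss1_ge0.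
Qed.

Lemma correct_prob2 (s : 'I_M -> Rn R 2) i (g : R) : 0 < g ->
  (\int[lebesgue_Rn 2]_(x in decision_region s i) (gaussian_density g x)%:E =
   \int[lebesgue_measure]_x \int[lebesgue_measure]_y
     (\1_[set z : measurableTypeR R * measurableTypeR R |
          decision_region s i (cons_Rn (z.1, cons_Rn (z.2, [tuple])))] (x, y) *
        gauss2 g (x, y))%:E)%E.
Proof.
move=> g0; rewrite integral_mkcond_indic.
have mf : measurable_fun setT (fun x : Rn R 2 =>
    (\1_(decision_region s i) x)%:E * (gaussian_density g x)%:E)%E.
  apply: emeasurable_funM; apply/measurable_EFinP.
    by apply: measurable_indic; exact: measurable_decision_region.
  exact: measurable_gaussian_density.
rewrite ge0_integral_RnS//; last first.
  by move=> x; rewrite -EFinM lee_fin mulr_ge0// gaussian_density_ge0.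
apply: eq_integral => x _.
have mfx := measurableT_comp mf (measurableT_comp (@measurable_cons_Rn R 1) (pair1_measurable x)).
rewrite ge0_integral_RnS//; last first.
  by move=> t; rewrite -EFinM lee_fin mulr_ge0// gaussian_density_ge0.
apply: eq_integral => y _; rewrite ge0_integral_Rn0; last first.
  exact: (measurableT_comp mfx (measurableT_comp (@measurable_cons_Rn R 0) (pair1_measurable y))).
by rewrite gaussian_density2// -EFinM !indicE.
Qed.

End dim12.

(** Dropping the indicator leaves a product of two normal densities of mass 1. The bound is what
    makes the probability of correct detection finite. *)
Lemma gauss2_plane_le1 {R : realType}
    (A : set (measurableTypeR R * measurableTypeR R)) (g : R) :
  measurable A -> 0 < g ->
  (\int[lebesgue_measure]_x \int[lebesgue_measure]_y
     (\1_A (x, y) * gauss2 g (x, y))%:E <= 1)%E.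
Proof.
move=> mA g0.
have m1 := measurable_gauss1 g.
pose k (z : measurableTypeR R * measurableTypeR R) := (\1_A z * gauss2 g z)%:E.
have mk : measurable_fun setT k.
  by apply/measurable_EFinP/measurable_funM => //; exact: measurable_gauss2.
have k0 z : (0 <= k z)%E by rewrite lee_fin mulr_ge0// gauss2_ge0.
have inner x : (\int[lebesgue_measure]_y k (x, y) <= (gauss1 g x)%:E)%E.
  have -> : ((gauss1 g x)%:E =
      \int[lebesgue_measure]_y ((gauss1 g x)%:E * (gauss1 g y)%:E))%E.
    rewrite ge0_integralZl//.
    - by rewrite integral_gauss1// mule1.
    - exact/measurable_EFinP.
    - by move=> y _; rewrite lee_fin gauss1_ge0.
    - by rewrite lee_fin gauss1_ge0.
  apply: ge0_le_integral => //.
  - exact: (measurableT_comp mk (pair1_measurable x)).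
  - by apply: measurable_funeM; exact/measurable_EFinP.
  - move=> y _; rewrite /k gauss2E// -EFinM lee_fin ler_piMl//.
    by rewrite mulr_ge0 ?gauss1_ge0.
rewrite -(integral_gauss1 _ g0); apply: ge0_le_integral => //.
- by move=> x _; apply: integral_ge0 => y _; exact: (k0 (x, y)).
- exact: (measurable_fun_fubini_tonelli_F k).
- exact/measurable_EFinP.
- by move=> x _; exact: inner.
Qed.

(** * Concavity of the probability of correct detection *)

Section correct_prob.
Context {R : realType} (n M : nat) (s : 'I_M -> Rn R n) (i : 'I_M).
Hypothesis n12 : n = 1%N \/ n = 2%N.

Definition correct_prob (g : R) : \bar R :=
  (\int[lebesgue_Rn n]_(x in decision_region s i) (gaussian_density g x)%:E)%E.

Lemma correct_prob_ge0 (g : R) : (0 <= correct_prob g)%E.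
Proof.
by apply: integral_ge0 => x _; rewrite lee_fin gaussian_density_ge0.
Qed.

(** A common planar form for both dimensions; in dimension 1, [A] is the product of the region with
    a full line. The set is the same for all [g], as needed to compare different SNRs. *)
Lemma correct_prob_plane : exists A : set (measurableTypeR R * measurableTypeR R),
  [/\ measurable A,
    forall (z : R * R) (l : R), A z -> 0 <= l <= 1 -> A (l * z.1, l * z.2) &
    forall g, 0 < g -> (correct_prob g = \int[lebesgue_measure]_x
      \int[lebesgue_measure]_y (\1_A (x, y) * gauss2 g (x, y))%:E)%E].
Proof.
rewrite /correct_prob; case: n12 s => -> s'.
- exists [set z | decision_region s' i (cons_Rn (z.1, [tuple]))]; split.
  + have mphi : measurable_fun setT
        (fun z : measurableTypeR R * measurableTypeR R =>
          cons_Rn (z.1, [tuple]) : Rn R 1).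
      exact: (measurable_cons measurable_fst (measurable_cst _)).
    by rewrite -[X in measurable X]setTI; apply: mphi => //;
      exact: measurable_decision_region.
  + move=> z l Az l01; apply: decision_region_star l01 _ Az => k.
    by rewrite (ord1 k).
  + by move=> g g0; rewrite correct_prob1.
- exists [set z | decision_region s' i (cons_Rn (z.1, cons_Rn (z.2, [tuple])))].
  split.
  + have mphi : measurable_fun setT
        (fun z : measurableTypeR R * measurableTypeR R =>
          cons_Rn (z.1, cons_Rn (z.2, [tuple])) : Rn R 2).
      exact: (measurable_cons measurable_fst
        (measurable_cons measurable_snd (measurable_cst _))).
    by rewrite -[X in measurable X]setTI; apply: mphi => //;
      exact: measurable_decision_region.
  + move=> z l Az l01; apply: decision_region_star l01 _ Az => k.
    by case: k => -[|[|//]] k2.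
  + by move=> g g0; rewrite correct_prob2.
Qed.

Lemma correct_prob_fin_num (g : R) : 0 < g -> correct_prob g \is a fin_num.
Proof.
move=> g0; have [A [mA _ AE]] := correct_prob_plane.
rewrite ge0_fin_numE ?correct_prob_ge0// AE//.
by rewrite (le_lt_trans (gauss2_plane_le1 _ _ mA g0))// ltry.
Qed.

Lemma econcave_gt0_correct_prob : econcave_gt0 correct_prob.
Proof.
have [A [mA starA AE]] := correct_prob_plane.
apply: (eq_econcave_gt0 _ _ (fun g g0 => esym (AE g g0))).
exact: econcave_gt0_plane.
Qed.

End correct_prob.

(** * Convexity and upper bound of the error rate on ]0, +oo[ *)

Definition convex_gt0 {R : realType} (f : R -> R) :=
  forall a b l : R, 0 < a -> 0 < b -> 0 <= l <= 1 ->
    f (l * a + (1 - l) * b) <= l * f a + (1 - l) * f b.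

(** [Rintegral] takes the [fine] part of [correct_prob]; finiteness at the three points involved
    turns extended concavity into a real inequality. *)
Lemma convex_gt0_cond_error_rate {R : realType} (n M : nat) (s : 'I_M -> Rn R n)
    (i : 'I_M) : n = 1%N \/ n = 2%N -> convex_gt0 (cond_error_rate s i).
Proof.
move=> n12 a b l a0 b0 l01; rewrite /cond_error_rate /Rintegral.
have cC := econcave_gt0_correct_prob n M s i n12 a b l a0 b0 l01.
have fina := correct_prob_fin_num n M s i n12 a a0.
have finb := correct_prob_fin_num n M s i n12 b b0.
have finc := correct_prob_fin_num n M s i n12 _ (conv_gt0 _ _ _ a0 b0 l01).
move: cC; rewrite -(fineK fina) -(fineK finb) -(fineK finc).
rewrite -!EFinM -EFinD lee_fin /correct_prob.
by move: (fine _) (fine _) (fine _) => u v w; clear; lra.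
Qed.

Lemma convex_gt0_error_rate_pos {R : realType} (n M : nat)
    (s : 'I_M -> Rn R n) (p : 'I_M -> R) : (forall i, 0 <= p i) ->
  n = 1%N \/ n = 2%N -> convex_gt0 (error_rate_pos s p).
Proof.
move=> p0 n12 a b l a0 b0 l01; rewrite /error_rate_pos !mulr_sumr -big_split/=.
apply: ler_sum => i _; rewrite !mulrA -mulrDl ler_wpM2r//.
exact: convex_gt0_cond_error_rate.
Qed.

Lemma error_rate_pos_le1 {R : realType} (n M : nat)
    (s : 'I_M -> Rn R n) (p : 'I_M -> R) (g : R) : prior p ->
  error_rate_pos s p g <= 1.
Proof.
move=> [p0 <-]; apply: ler_sum => i _; rewrite ler_piMl//.
rewrite gerBl fine_ge0//; apply: integral_ge0 => x _.
by rewrite lee_fin gaussian_density_ge0.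
Qed.

(** * Convex functions bounded above: monotonicity and extension to 0 *)

Lemma convex_ray_ub_le {R : realType} (f : R -> R) (M x y : R) :
  (forall z l, x < z -> 0 <= l <= 1 ->
    f (l * x + (1 - l) * z) <= l * f x + (1 - l) * f z) ->
  (forall z, x <= z -> f z <= M) -> x <= y -> f y <= f x.
Proof.
move=> cf fM; rewrite le_eqVlt => /predU1P[->//|xy].
(* If f rose by d > 0 from x to y, convexity would keep f above the line through these two points
   beyond y, and that line exceeds M far enough to the right. *)
rewrite leNgt; apply/negP => fxy.
pose d := f y - f x; have d0 : 0 < d by rewrite subr_gt0.
pose C := (y - x) * (M - f x).
have fMx := fM _ (lexx x).
(* Chosen so that (z - x) d > (y - x) (M - f x), that is, the line has passed M at z; the summand 1
   gives [y < z] from [0 <= C] alone. *)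
pose z := y + 1 + C / d.
have C0 : 0 <= C by rewrite /C mulr_ge0 ?subr_ge0// ltW.
have zd : z * d = (y + 1) * d + C by rewrite /z mulrDl divfK// gt_eqF.
have yz : y < z.
  by rewrite /z -addrA ltrDl ltr_wpDr// divr_ge0// ltW.
have zx : 0 < z - x by rewrite subr_gt0 (lt_trans xy).
pose l := (z - y) / (z - x).
have l01 : 0 <= l <= 1.
  apply/andP; split; first by rewrite divr_ge0// ltW// subr_gt0.
  by rewrite ler_pdivrMr// mul1r lerD2l lerN2 ltW.
have xz : x < z by rewrite (lt_trans xy).
have := cf z l xz l01.
have -> : l * x + (1 - l) * z = y.
  by rewrite /l; field; rewrite gt_eqF.
have l1 : 0 <= 1 - l by rewrite subr_ge0; case/andP: l01.
have /(ler_wpM2l l1) := fM _ (ltW xz) => h1 h2.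
have h : f y <= l * f x + (1 - l) * M by rewrite (le_trans h2)// lerD2l.
have le : 1 - l = (y - x) / (z - x) by rewrite /l; field; rewrite gt_eqF.
have : d <= (1 - l) * (M - f x) by rewrite /d; lra.
rewrite le mulrAC ler_pdivlMr// -/C mulrC mulrBl zd.
rewrite leNgt => /negP; apply.
nra.
Qed.

Lemma convex_gt0_ub_nonincreasing {R : realType} (f : R -> R) (M : R) :
  convex_gt0 f -> (forall x, 0 < x -> f x <= M) ->
  forall x y, 0 < x -> x <= y -> f y <= f x.
Proof.
move=> cf fM x y x0; apply: (convex_ray_ub_le f M) => z.
- by move=> l xz; apply: cf => //; exact: lt_trans xz.
- by move=> xz; apply: fM; exact: lt_le_trans xz.
Qed.

(** Being nonincreasing and bounded above, f tends at 0 from the right to its supremum, so the [lim]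
    at 0 is a genuine limit and not a default value. *)
Lemma convex_gt0_ub_cvg {R : realType} (f : R -> R) (M : R) :
  convex_gt0 f -> (forall x, 0 < x -> f x <= M) ->
  cvg (f x @[x --> 0^'+]).
Proof.
move=> cf fM; apply/cvg_ex; exists (sup [set f x | x in `]0, +oo[%classic]).
apply: nonincreasing_at_right_cvgr => //.
- move=> y x; rewrite !in_itv/= !andbT => y0 x0.
  exact: (convex_gt0_ub_nonincreasing _ M).
- by exists M => _ [x + <-]; rewrite /= in_itv/= andbT; exact: fM.
Qed.

(** The point y = (1 - l) b is held fixed while the left endpoint c shrinks to 0, so continuity of f
    at y is not called upon; monotonicity bounds f c by the limit. The condition [l < 1] keeps y
    positive. *)
Lemma convex_gt0_at0 {R : realType} (f : R -> R) (M : R) :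
  convex_gt0 f -> (forall x, 0 < x -> f x <= M) ->
  forall b l : R, 0 < b -> 0 <= l < 1 ->
  f ((1 - l) * b) <= l * lim (f x @[x --> 0^'+]) + (1 - l) * f b.
Proof.
move=> cf fM b l b0 /andP[l0 l1].
have cvf := convex_gt0_ub_cvg f M cf fM.
have nf := convex_gt0_ub_nonincreasing f M cf fM.
set L := lim _.
have fL c : 0 < c -> f c <= L.
  move=> c0; apply: limr_ge => //.
  near=> x; apply: nf => //.
  by near: x; exact: nbhs_right_le.
set y := (1 - l) * b.
have y0 : 0 < y by rewrite mulr_gt0// subr_gt0.
have yb : y <= b by rewrite /y ler_piMl ?(ltW b0)//; lra.
(* y is the average of c and b with weight m = l b / (b - c), which tends to l
   as c tends to 0. *)
have key c : 0 < c -> c < y -> (f y - f b) * (b - c) <= l * b * (L - f b).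
  move=> c0 cy; have bc : 0 < b - c by rewrite subr_gt0 (lt_le_trans cy).
  pose m := l * b / (b - c).
  have m0 : 0 <= m by rewrite /m divr_ge0 ?mulr_ge0 ?(ltW b0) ?(ltW bc).
  have m01 : 0 <= m <= 1.
    by rewrite m0/= ler_pdivrMr// mul1r; move: cy; rewrite /y; lra.
  have := cf c b m c0 b0 m01.
  have -> : m * c + (1 - m) * b = y by rewrite /m /y; field; rewrite gt_eqF.
  have := ler_wpM2l m0 (fL _ c0) => h1 h2.
  have h : f y - f b <= m * (L - f b) by lra.
  by rewrite -ler_pdivlMr// mulrAC.
rewrite leNgt; apply/negP => hlt.
have Lb := fL _ b0.
pose X := f y - f b.
have h : l * (L - f b) < X by rewrite /X; lra.
have X0 : 0 < X by rewrite (le_lt_trans _ h)// mulr_ge0 ?subr_ge0.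
(* [key] rearranges to X c >= X b - l b (L - f b) = 2 X e, which fails as soon as c <= e. *)
pose e := (X * b - l * b * (L - f b)) / (2 * X).
have e0 : 0 < e.
  rewrite /e divr_gt0 ?mulr_gt0// subr_gt0 mulrAC ltr_pM2r//.
have eX : e * (2 * X) = X * b - l * b * (L - f b).
  by rewrite /e divfK// gt_eqF// mulr_gt0.
pose c := Num.min (y / 2) e.
have c0 : 0 < c by rewrite /c lt_min e0 divr_gt0.
have cy : c < y by rewrite /c gt_min; apply/orP; left; lra.
have ce : c <= e by rewrite /c ge_min lexx orbT.
have := key c c0 cy; rewrite -/X; nra.
Unshelve. all: by end_near. Qed.

Lemma convex_function_itvcyP {R : realType} (f : R -> R) :
  convex_function (`[0, +oo[%classic : set R) f <->
  (forall x y l : R, 0 <= x -> 0 <= y -> 0 <= l <= 1 ->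
    f (l * x + (1 - l) * y) <= l * f x + (1 - l) * f y).
Proof.
split=> [cf x y l x0 y0 /andP[l0 l1]|cf t x y].
  by apply: (cf (Itv01 l0 l1) x y); rewrite inE/= in_itv/= andbT.
rewrite !inE/= !in_itv/= !andbT => x0 y0.
by apply: cf => //; rewrite ge0 le1.
Qed.

Lemma convex_function_lim0 {R : realType} (f : R -> R) (M : R) :
  convex_gt0 f -> (forall x, 0 < x -> f x <= M) ->
  convex_function (`[0, +oo[%classic : set R)
    (fun g => if 0 < g then f g else lim (f x @[x --> 0^'+])).
Proof.
move=> cf fM; apply/convex_function_itvcyP => x y l; set L := lim _.
have at0 b m := convex_gt0_at0 f M cf fM b m; rewrite -/L in at0.
move=> + + l01; rewrite [0 <= x]le_eqVlt [0 <= y]le_eqVlt.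
move=> /predU1P[<-|x0] /predU1P[<-|y0].
- by rewrite !mulr0 addr0 ltxx; lra.
- rewrite mulr0 add0r ltxx y0; case: ltP => ly0.
    have l1 : l < 1 by move: ly0; rewrite pmulr_lgt0// subr_gt0.
    by apply: at0 => //; move: l01; lra.
  (* An average of 0 and y > 0 that is not positive puts all its weight on 0. *)
  have -> : l = 1.
    by move: ly0; rewrite pmulr_lle0// subr_le0; move: l01; lra.
  by lra.
- rewrite mulr0 addr0 ltxx x0; case: ltP => lx0.
    have l0 : 0 < l by move: lx0; rewrite pmulr_lgt0.
    have l1 : 0 <= 1 - l < 1 by move: l01; lra.
    by have := at0 x (1 - l) x0 l1; rewrite subKr; lra.
  have -> : l = 0.
    by move: lx0; rewrite pmulr_lle0//; move: l01; lra.
  by lra.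
- by rewrite x0 y0 conv_gt0 ?cf.
Qed.

(** * Jensen's inequality for convex functions bounded above on [0, +oo[ *)

Section jensen.
Context {R : realType} (f : R -> R) (M : R).
Hypothesis cf : forall x y l : R, 0 <= x -> 0 <= y -> 0 <= l <= 1 ->
    f (l * x + (1 - l) * y) <= l * f x + (1 - l) * f y.
Hypothesis fM : forall x, 0 <= x -> f x <= M.

(** Monotonicity provides the measurability of [f \o X] in [jensen_expectation], without continuity
    of f at 0. *)
Lemma convex_ge0_ub_nonincreasing (x y : R) : 0 <= x -> x <= y -> f y <= f x.
Proof.
move=> x0; apply: (convex_ray_ub_le f M) => z.
- by move=> l /ltW xz; apply: cf => //; exact: le_trans xz.
- by move=> xz; apply: fM; exact: le_trans xz.
Qed.

(** The slope is the supremum of the chord slopes to the left of m, which the three-chord inequality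
    bounds by every chord slope to the right. Since m > 0, there are points to the left. *)
Lemma convex_supporting_line (m : R) : 0 < m ->
  exists c : R, forall x, 0 <= x -> f m + c * (x - m) <= f x.
Proof.
move=> m0.
have slopes x z : 0 <= x -> x < m -> m < z ->
    (f m - f x) / (m - x) <= (f z - f m) / (z - m).
  move=> x0 xm mz.
  have mx : 0 < m - x by rewrite subr_gt0.
  have zm : 0 < z - m by rewrite subr_gt0.
  have zx : 0 < z - x by lra.
  rewrite ler_pdivrMr// mulrAC ler_pdivlMr//.
  pose l := (z - m) / (z - x).
  have l01 : 0 <= l <= 1.
    apply/andP; split; first by rewrite divr_ge0// ltW.
    by rewrite ler_pdivrMr//; lra.
  have z0 : 0 <= z by lra.
  have := cf x z l x0 z0 l01.
  have -> : l * x + (1 - l) * z = m by rewrite /l; field; rewrite gt_eqF.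
  have -> : l * f x + (1 - l) * f z =
      ((z - m) * f x + (m - x) * f z) / (z - x).
    by rewrite /l; field; rewrite gt_eqF.
  rewrite ler_pdivlMr//; lra.
pose S := [set (f m - f x) / (m - x) | x in `[0, m[%classic].
have ubS : ubound S ((f (m + 1) - f m) / (m + 1 - m)).
  by move=> _ [x /= + <-]; rewrite in_itv/= => /andP[x0 xm]; apply: slopes => //;
    rewrite ltrDl.
have S0 : S !=set0.
  by exists ((f m - f 0) / (m - 0)); exists 0 => //=; rewrite in_itv/= lexx.
exists (sup S) => x x0; have [xm|mx|->] := ltgtP x m.
- have : (f m - f x) / (m - x) <= sup S.
    apply: ub_le_sup; first by exists ((f (m + 1) - f m) / (m + 1 - m)).
    by exists x => //=; rewrite in_itv/= x0.
  by rewrite ler_pdivrMr ?subr_gt0//; lra.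
- have : sup S <= (f x - f m) / (x - m).
    apply: ge_sup => // _ [y /= + <-]; rewrite in_itv/= => /andP[y0 ym].
    exact: slopes.
  by rewrite ler_pdivlMr ?subr_gt0//; lra.
- by rewrite subrr mulr0 addr0.
Qed.

Lemma jensen_expectation d (T : measurableType d) (P : probability T R)
    (X : {RV P >-> R}) : (forall w, 0 <= X w) -> (X : T -> R) \in Lfun P 1 ->
  ((f (fine 'E_P[X]))%:E <= 'E_P[f \o X])%E.
Proof.
move=> X0 /Lfun1_integrable iX; rewrite unlock.
have mX : measurable_fun setT X by exact: measurable_funP.
have mfX : measurable_fun setT (f \o X).
  (* f is controlled only on [0, +oo[; clamping its argument at 0 gives a function nonincreasing on
     all of R that agrees with f on the values of [X]. *)
  have mf : measurable_fun [set: R] (fun x => f (Num.max 0 x)).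
    apply: nonincreasing_measurable => // x y xy.
    apply: convex_ge0_ub_nonincreasing; first by rewrite le_max lexx.
    by rewrite ge_max le_max lexx/= le_max xy orbT.
  rewrite (_ : f \o X = (fun x => f (Num.max 0 x)) \o X).
    exact: measurableT_comp mf mX.
  by apply/funext => w /=; rewrite max_r.
have EX0 : (0 <= \int[P]_w (X w)%:E)%E.
  by apply: integral_ge0 => w _; rewrite lee_fin.
have finEX : (\int[P]_w (X w)%:E)%E \is a fin_num by exact: integrable_fin_num.
set m := fine _.
have mE : (\int[P]_w (X w)%:E = m%:E)%E by rewrite fineK.
have : 0 <= m by rewrite fine_ge0.
rewrite le_eqVlt => /predU1P[m0|m0].
  have X_ae0 : ae_eq P setT (EFin \o X) (cst 0%E).
    apply/(ae_eq_integral_abs P measurableT).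
      by apply/measurable_EFinP.
    transitivity (\int[P]_w (X w)%:E)%E; last by rewrite mE -m0.
    by apply: eq_integral => w _; rewrite gee0_abs// lee_fin.
  rewrite -m0.
  rewrite (@ae_eq_integral _ _ _ P setT (cst (f 0)%:E))//.
  - by rewrite integral_cst//= probability_setT mule1.
  - exact/measurable_EFinP.
  - apply: filterS X_ae0 => w /= /(_ I) Xw _.
    by case: Xw => ->.
have [c cP] := convex_supporting_line _ m0.
pose a := f m - c * m.
have affE w : f m + c * (X w - m) = a + c * X w by rewrite /a; ring.
have icX : P.-integrable setT (EFin \o (fun w => c * X w)).
  exact: (integrableZl measurableT c iX).
have ia : P.-integrable setT (EFin \o cst a).
  exact: finite_measure_integrable_cst.
have iaff : P.-integrable setT (EFin \o (fun w => a + c * X w)).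
  exact: (integrableD measurableT ia icX).
(* [f \o X] lies between its affine minorant and the constant M, so its absolute value is at most
   |M| + |a + c X|. *)
have ifX : P.-integrable setT (EFin \o (f \o X)).
  apply: (le_integrable measurableT (f := EFin \o (f \o X))
    (g := EFin \o (fun w => `|M| + `|a + c * X w|))).
  - exact/measurable_EFinP.
  - move=> w _; rewrite !abse_EFin lee_fin [leRHS]ger0_norm ?addr_ge0//.
    have := fM _ (X0 w); have := cP _ (X0 w); rewrite affE /=.
    rewrite ler_norml => h1 h2.
    have := ler_norm M; have := ler_norm (- (a + c * X w)); rewrite normrN.
    have := normr_ge0 M; have := normr_ge0 (a + c * X w).
    by move=> *; apply/andP; split; lra.
  - apply: (integrableD measurableT (f := EFin \o cst `|M|)
      (g := EFin \o (fun w => `|a + c * X w|))).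
      exact: finite_measure_integrable_cst.
    exact: (integrable_abse iaff).
(* As a = f m - c m, the affine minorant has expectation exactly f m. *)
have <- : (\int[P]_w (a + c * X w)%:E = (f m)%:E)%E.
  rewrite (integralD_EFin measurableT ia icX).
  rewrite (integral_cst P measurableT a%:E)/= probability_setT mule1.
  rewrite (integralZl measurableT iX) mE -EFinM -EFinD; congr EFin.
  by rewrite /a; ring.
by apply: le_integral => // w _; rewrite lee_fin/= -affE cP.
Qed.

End jensen.

(** * The averaging inequality, and convexity in dimensions 1 and 2 *)

Theorem theorem16 (R : realType) (n M : nat) (s : 'I_M -> Rn R n)
    (p : 'I_M -> R) (hs : constellation s) (hp : prior p) :
  (convex_function (`[0, +oo[%classic : set R) (error_rate s p) ->
    forall (d : measure_display) (T : measurableType d) (P : probability T R)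
      (X : {RV P >-> R}),
      (forall w, 0 <= X w) -> (X : T -> R) \in Lfun P 1 ->
      ((error_rate s p (fine 'E_P[X]))%:E <= 'E_P[error_rate s p \o X])%E) /\
  (n = 1%N \/ n = 2%N ->
    convex_function (`[0, +oo[%classic : set R) (error_rate s p)).
Proof.
split=> [/convex_function_itvcyP cf d T P X X0 X1|n12].
  (* The value at 0 is a [lim], which the bound 1 on ]0, +oo[ does not cover, so it enters the upper
     bound itself. *)
  apply: (jensen_expectation _ (Num.max 1 (error_rate s p 0)) cf) => // g.
  rewrite le_max le_eqVlt => /predU1P[<-|g0]; first by rewrite lexx orbT.
  by rewrite /error_rate g0 error_rate_pos_le1.
apply: (convex_function_lim0 _ 1) => [|g g0]; last exact: error_rate_pos_le1.
by apply: convex_gt0_error_rate_pos => //; case: hp.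
Qed.
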